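(* Let $\theta=0$, $K\ge1$ (with the convention that $h=\mathrm{id}$ when $K=1$) and $c_K:=1/(2K)$. Then $c_K\notin\mathcal{M}_{K,0}$ and $\sigma(c_K)\ge1$, so that $t_0\ge G_{\mathcal{M}}(c_K)>0$. Moreover, $G_{\mathcal{M}}(c_K)\ge1/26$ for $1\le K\le2$.
   Context: For $K\ge1$ and $\theta\in(-\pi/2,\pi/2]$ let $h(z)=\frac{K+1}{2}z+e^{2i\theta}\frac{K-1}{2}\overline{z}$ (for $\theta=0$: $h(x+iy)=Kx+iy$). For $c\in\mathbb{C}$ let $f_c(z)=h(z)^2+c$, with iterates $f_c^n$. Set $I(f_c)=\{z: f_c^n(z)\to\infty\}$, $BO(f_c)=\mathbb{C}\setminus I(f_c)$, $\mathcal{M}_{K,\theta}=\{c\in\mathbb{C}:0\in BO(f_c)\}$, and $P_n(c)=f_c^n(c)=f_c^{n+1}(0)$ for $n\ge0$. Böttcher coordinate $\psi_c$ (known, Fletcher–Fryer): near infinity put $\psi_0=\mathrm{id}$ and $\psi_{k+1}=f_0^{-1}\circ\psi_k\circ f_c$, the branch of $f_0^{-1}$ being chosen so that $\psi_{k+1}(z)=z+o(1)$ as $|z|\to\infty$. The sequence $(\psi_k)$ converges uniformly on a neighbourhood of infinity to a quasiconformal map $\psi_c$ with $\psi_c\circ f_c=f_0\circ\psi_c$ there. Green's function (known, Broderius–Fletcher): for each $\phi$ the ray $\{te^{i\phi}:t\ge0\}$ meets $\partial I(f_0)$ in exactly one point $b_{K,\theta}(\phi)$. $G_0(z)=\log(|z|/|b_{K,\theta}(\arg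 z)|)$ for $z\in I(f_0)$ and $G_0=0$ on $BO(f_0)$. For general $c$, $G_c=G_0\circ\psi_c$ in a neighbourhood of infinity, extended to $I(f_c)$ by $G_c(f_c(z))=2G_c(z)$, and $G_c=0$ on $BO(f_c)$. (For $K=1$ this is the usual Green's function of $z^2+c$.) $G_c:\mathbb{C}\to[0,\infty)$ is continuous, positive exactly on $I(f_c)$. Set $G_{\mathcal{M}}(c):=G_c(c)$. For $n\ge1$, $\sigma_n(c):=\sum_{j=1}^n\prod_{i=0}^{j-1}\frac{1}{2|h(P_i(c))|}$ and $\sigma(c):=\lim_{n}\sigma_n(c)\in(0,\infty]$, with $\sigma_n(c)=\sigma(c)=\infty$ if $P_i(c)=0$ for some $i\le n-1$. $\Omega^*:=\{c\in\mathbb{C}\setminus\mathcal{M}_{K,\theta}:\sigma(c)<1\}$ and $t_0:=\inf\{t>0:\{G_{\mathcal{M}}>s\}\subset\Omega^*\text{ for all }s\ge t\}$. *)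

(* Defs.v *)
From Stdlib Require Import Reals ClassicalEpsilon.
From Coquelicot Require Import Coquelicot.

Open Scope R_scope.

Definition cis (t : R) : C := (cos t, sin t).

(** The parameters of the family are [K >= 1] and [-PI/2 < th <= PI/2]; these
    constraints are imposed where the definitions are used. *)
Definition h (K th : R) (z : C) : C :=
  (RtoC ((K + 1) / 2) * z + cis (2 * th) * RtoC ((K - 1) / 2) * Cconj z)%C.

Definition fc (K th : R) (c z : C) : C := (h K th z * h K th z + c)%C.

Definition fiter (K th : R) (c : C) (n : nat) (z : C) : C :=
  Nat.iter n (fc K th c) z.

Definition escaping (K th : R) (c z : C) : Prop :=
  is_lim_seq (fun n => Cmod (fiter K th c n z)) p_infty.

Definition bounded_orbit (K th : R) (c z : C) : Prop := ~ escaping K th c z.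

Definition Mandel (K th : R) (c : C) : Prop := bounded_orbit K th c (RtoC 0).

Definition Pn (K th : R) (n : nat) (c : C) : C := fiter K th c n c.

(** * Boettcher coordinate *)

Definition near_infinity (A : C -> Prop) : Prop :=
  exists r : R, forall z : C, r < Cmod z -> A z.

(** [psi k] is the k-th approximant, meaningful only on [r < Cmod z].  The map
    [f_0] is two-to-one around infinity, so "a branch of [f_0^{-1}]" means a
    continuous lift of [psi k o f_c] through [f_0]; the normalization
    [psi (S k) z = z + o(1)] selects one of the two lifts. *)
Definition is_boettcher_seq (K th : R) (c : C) (r : R) (psi : nat -> C -> C)
  : Prop :=
  (forall z, r < Cmod z -> r < Cmod (fc K th c z)) /\
  (forall z, r < Cmod z -> psi 0%nat z = z) /\
  (forall k,
     (forall z, r < Cmod z -> fc K th (RtoC 0) (psi (S k) z) = psi k (fc K th c z)) /\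
     (forall z, r < Cmod z -> continuous (psi (S k)) z) /\
     filterlim (fun z => psi (S k) z - z)%C near_infinity (locally (RtoC 0))).

Definition is_boettcher (K th : R) (c : C) (r : R) (psi : C -> C) : Prop :=
  exists psis : nat -> C -> C,
    is_boettcher_seq K th c r psis /\
    forall eps : R, 0 < eps ->
      exists N : nat, forall n : nat, (N <= n)%nat ->
        forall z : C, r < Cmod z -> Cmod (psis n z - psi z)%C < eps.

(** * Green's function *)

Definition boundary (A : C -> Prop) (z : C) : Prop :=
  forall V : C -> Prop, locally z V ->
    (exists x, V x /\ A x) /\ (exists y, V y /\ ~ A y).

(** The argument in [(-PI, PI]]; unspecified at [0]. *)
Definition Carg (z : C) : R :=
  epsilon (inhabits 0) (fun t => - PI < t <= PI /\ z = (RtoC (Cmod z) * cis t)%C).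

Definition ray (phi : R) (z : C) : Prop :=
  exists t : R, 0 <= t /\ z = (RtoC t * cis phi)%C.

(** The unique point of the boundary of [I(f_0)] on the ray of angle [phi]. *)
Definition ray_point (K th phi : R) : C :=
  epsilon (inhabits (RtoC 0))
    (fun w => ray phi w /\ boundary (escaping K th (RtoC 0)) w).

Definition G0 (K th : R) (z : C) : R :=
  if excluded_middle_informative (escaping K th (RtoC 0) z)
  then ln (Cmod z / Cmod (ray_point K th (Carg z)))
  else 0.

(** The germ of the Boettcher coordinate at infinity is unique, and every
    escaping orbit enters any neighbourhood of infinity, so these conditions
    determine [g] on all of [C]. *)
Definition is_green (K th : R) (c : C) (g : C -> R) : Prop :=
  (exists (r : R) (psi : C -> C),
     is_boettcher K th c r psi /\
     forall z, r < Cmod z -> g z = G0 K th (psi z)) /\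
  (forall z, escaping K th c z -> g (fc K th c z) = 2 * g z) /\
  (forall z, bounded_orbit K th c z -> g z = 0).

Definition G (K th : R) (c : C) : C -> R :=
  epsilon (inhabits (fun _ : C => 0)) (is_green K th c).

Definition GM (K th : R) (c : C) : R := G K th c c.

(** * The series [sigma], the set [Omega^*] and the threshold [t_0] *)

Definition sigma_partial (K th : R) (n : nat) (c : C) : Rbar :=
  if excluded_middle_informative
       (exists i : nat, (i < n)%nat /\ Pn K th i c = RtoC 0)
  then p_infty
  else Finite
    (sum_n_m
       (fun j => prod_f_R0 (fun i => 1 / (2 * Cmod (h K th (Pn K th i c)))) (j - 1))
       1 n).

(** In the second case every [sigma_partial] is finite, so that [real] loses
    nothing. *)
Definition sigma_series (K th : R) (c : C) : Rbar :=
  if excluded_middle_informative (exists i : nat, Pn K th i c = RtoC 0)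
  then p_infty
  else Lim_seq (fun n => real (sigma_partial K th n c)).

Definition Omega_star (K th : R) (c : C) : Prop :=
  ~ Mandel K th c /\ Rbar_lt (sigma_series K th c) (Finite 1).

(** Valued in [Rbar], with the infimum of the empty set equal to [p_infty]. *)
Definition t0 (K th : R) : Rbar :=
  Glb_Rbar (fun t => 0 < t /\
    forall s : R, t <= s -> forall c : C, s < GM K th c -> Omega_star K th c).

(* Main.v *)
(* On the positive real axis [f_c] is [x |-> K^2 x^2 + c], and [K^2 x] conjugates
   it to [u |-> u^2 + K^2 c]; for [c = c_K] this is [u |-> u^2 + K/2] started at
   [u = K/2], which increases to infinity.  There the Boettcher coordinate is real
   and satisfies [psi_c x >= x], so that [G_c x >= log (K^2 x)] for large [x];
   pulling back along the orbit, [G_c c >= 2^-n log (K^2 P_n)] for every [n].  The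
   first term of [sigma (c_K)] is [1 / (2 |h c_K|) = 1].

   Since [G_c] is given by its defining properties, its existence must be proved.
   The lifts are [psi_(k+1) z = h^-1 w], with [w] the square root of
   [psi_k (f_c z)] nearest to [h z]; they form a geometric sequence on
   [|z| > |c| + 3].  Extending [G_0 o psi_c] to all escaping points requires
   [G_0 o f_0 = 2 G_0], which follows from real homogeneity: if [t w] escapes
   under [f_0] exactly for [t] beyond [tau], the threshold of [f_0 w] is [tau^2]. *)

Require Import Defs.
From Stdlib Require Import Reals Lra Lia ClassicalEpsilon.
From Coquelicot Require Import Coquelicot.

Open Scope R_scope.


(** * The modulus on [C], and continuity expressed through it *)

Lemma Ceq (z w : C) : fst z = fst w -> snd z = snd w -> z = w.
Proof. destruct z, w; simpl; congruence. Qed.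

Lemma Cmod_le_abs (z : C) : Cmod z <= Rabs (fst z) + Rabs (snd z).
Proof.
  replace z with ((fst z, 0) + (0, snd z))%C at 1
    by (apply Ceq; simpl; ring).
  eapply Rle_trans; [apply Cmod_triangle|]. unfold Cmod; simpl.
  rewrite !Rmult_1_r, !Rmult_0_l, Rplus_0_r, Rplus_0_l.
  rewrite <- !sqrt_Rsqr_abs. unfold Rsqr. lra.
Qed.

Lemma Rabs_fst_le (z : C) : Rabs (fst z) <= Cmod z.
Proof. eapply Rle_trans; [apply Rmax_l | apply Rmax_Cmod]. Qed.

Lemma Rabs_snd_le (z : C) : Rabs (snd z) <= Cmod z.
Proof. eapply Rle_trans; [apply Rmax_r | apply Rmax_Cmod]. Qed.

Lemma Cmod_sqr (z : C) : Cmod z * Cmod z = fst z * fst z + snd z * snd z.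
Proof. unfold Cmod. rewrite sqrt_sqrt; [ring | nra]. Qed.

Lemma Cmod_minus_sym (z w : C) : Cmod (z - w) = Cmod (w - z).
Proof. rewrite <- Cmod_opp. f_equal. ring. Qed.

Lemma Cmod_triangle_minus (z w u : C) : Cmod (z - u) <= Cmod (z - w) + Cmod (w - u).
Proof.
  replace (z - u)%C with ((z - w) + (w - u))%C by ring. apply Cmod_triangle.
Qed.

Lemma Cmod_triangle_sub (z w : C) : Cmod z <= Cmod w + Cmod (z - w).
Proof.
  replace z with (w + (z - w))%C at 1 by ring. apply Cmod_triangle.
Qed.

Lemma Cmod_scal (t : R) (z : C) : 0 <= t -> Cmod (RtoC t * z) = t * Cmod z.
Proof. intros Ht. now rewrite Cmod_mult, Cmod_R, Rabs_pos_eq. Qed.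

(** The balls of [C] as a product space are squares; the square of radius [d / sqrt 2] lies in the
    disc of radius [d]. *)
Lemma locally_Cmod (z : C) (P : C -> Prop) :
  locally z P <-> exists d, 0 < d /\ forall y, Cmod (y - z) < d -> P y.
Proof.
  split.
  - intros [d Hd]. exists d. split; [apply cond_pos|].
    intros y Hy. apply Hd. apply C_NormedModule_mixin_compat1, Hy.
  - intros (d & Hd & H).
    assert (H2 : 0 < sqrt 2) by (apply sqrt_lt_R0; lra).
    assert (Hd' : 0 < d / sqrt 2) by now apply Rdiv_lt_0_compat.
    exists (mkposreal _ Hd'). intros y Hy. apply H.
    apply C_NormedModule_mixin_compat2 in Hy. simpl in Hy.
    replace d with (sqrt 2 * (d / sqrt 2)) by (field; lra). exact Hy.
Qed.

Lemma continuous_Cmod (f : C -> C) (z : C) :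
  continuous f z <->
  forall eps, 0 < eps ->
    exists d, 0 < d /\ forall y, Cmod (y - z) < d -> Cmod (f y - f z) < eps.
Proof.
  split.
  - intros Hf eps He.
    apply (locally_Cmod z (fun y => Cmod (f y - f z) < eps)).
    apply (Hf (fun w => Cmod (w - f z) < eps)).
    apply locally_Cmod. now exists eps.
  - intros Hf P HP. apply locally_Cmod in HP. destruct HP as (e & He & HP).
    destruct (Hf e He) as (d & Hd & H). apply locally_Cmod.
    exists d. split; [exact Hd|]. intros y Hy. apply HP, H, Hy.
Qed.

Lemma continuous_pair {T : UniformSpace} (f : T -> C) (x : T) :
  continuous (fun t => fst (f t)) x -> continuous (fun t => snd (f t)) x ->
  continuous f x.
Proof.
  intros H1 H2 P [e HP].
  assert (E1 := H1 _ (locally_ball (fst (f x)) e)).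
  assert (E2 := H2 _ (locally_ball (snd (f x)) e)).
  unfold filtermap in *.
  generalize (filter_and _ _ E1 E2). apply filter_imp.
  intros t [Ht1 Ht2]. apply HP. now split.
Qed.

Lemma continuous_fst_C (z : C) : continuous (fun w : C => fst w) z.
Proof. intros P [e HP]. exists e. intros y [Hy _]. apply HP, Hy. Qed.

Lemma continuous_snd_C (z : C) : continuous (fun w : C => snd w) z.
Proof. intros P [e HP]. exists e. intros y [_ Hy]. apply HP, Hy. Qed.

(** * Square roots near a given point *)

Lemma Csqrt_exists (u : C) : 0 < fst u -> exists s : C, (s * s)%C = u /\ 0 <= fst s.
Proof.
  intros Hu. destruct u as [a b]; simpl in Hu.
  set (m := Cmod (a, b)).
  assert (Hm : m * m = a * a + b * b) by exact (Cmod_sqr (a, b)).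
  assert (Hm0 : 0 <= m) by apply Cmod_ge_0.
  (* A root [p + i q] satisfies [p^2 - q^2 = a] and [p^2 + q^2 = m], whence [p]; then [2 p q = b]
     gives [q]. *)
  set (p := sqrt ((m + a) / 2)).
  assert (Hp : 0 < p) by (apply sqrt_lt_R0; lra).
  assert (Hpp : p * p = (m + a) / 2) by (apply sqrt_sqrt; lra).
  exists (p, b / (2 * p)). split; [|simpl; lra].
  apply Ceq; simpl.
  - replace (p * p - b / (2 * p) * (b / (2 * p)))
      with (p * p - b * b / (4 * (p * p))) by (field; lra).
    rewrite Hpp. replace (b * b) with (m * m - a * a) by lra.
    field. lra.
  - field. lra.
Qed.

(** Write [v = a^2 (1 + d)] with [|d| <= 1/2] and take [w = a s], where [s] is the root of [1 + d]
    with nonnegative real part: [(s - 1)(s + 1) = d] and [|s + 1| >= 1] give [|s - 1| <= |d|].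
    Stated as a product, the bound also covers [a = 0]. *)
Lemma Croot_near_exists (a v : C) :
  Cmod (v - a * a) <= Cmod a * Cmod a / 2 ->
  exists w : C, (w * w)%C = v /\ Cmod (w - a) * Cmod a <= Cmod (v - a * a).
Proof.
  intros Hv. destruct (Ceq_dec a 0) as [->|Ha].
  - exists 0%C. rewrite Cmod_0 in *.
    assert (E : Cmod (v - 0 * 0) = 0).
    { generalize (Cmod_ge_0 (v - 0 * 0)). lra. }
    apply Cmod_eq_0 in E. split; [|rewrite Rmult_0_r; apply Cmod_ge_0].
    replace v with (v - 0 * 0)%C by ring. rewrite E. ring.
  - set (d := ((v - a * a) / (a * a))%C).
    assert (Ha0 : 0 < Cmod a) by now apply Cmod_gt_0.
    assert (Haa : (a * a)%C <> 0) by now apply Cmult_neq_0.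
    assert (Hd : Cmod d * (Cmod a * Cmod a) = Cmod (v - a * a)).
    { unfold d. rewrite Cmod_div, Cmod_mult by assumption. field. lra. }
    assert (Hd2 : Cmod d <= 1 / 2).
    { apply Rmult_le_reg_r with (Cmod a * Cmod a); nra. }
    destruct (Csqrt_exists (1 + d)) as (s & Hs & Hs0).
    { assert (E := Rabs_fst_le d). assert (E' := Rle_abs (- fst d)). rewrite Rabs_Ropp in E'. change (0 < 1 + fst d). lra. }
    assert (Hs1 : Cmod (s - 1) <= Cmod d).
    { replace d with ((s - 1) * (s + 1))%C
        by (replace d with ((1 + d) - 1)%C by ring; rewrite <- Hs; ring).
      rewrite Cmod_mult.
      assert (1 <= Cmod (s + 1)).
      { eapply Rle_trans; [|apply Rabs_fst_le]. simpl.
        rewrite Rabs_pos_eq; lra. }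
      generalize (Cmod_ge_0 (s - 1)). nra. }
    exists (a * s)%C. split.
    + replace (a * s * (a * s))%C with (a * a * (s * s))%C by ring.
      rewrite Hs. unfold d. field. exact Ha.
    + replace (a * s - a)%C with (a * (s - 1))%C by ring.
      rewrite Cmod_mult, <- Hd. nra.
Qed.

Definition Croot_near (a v : C) : C :=
  epsilon (inhabits (RtoC 0))
    (fun w => (w * w)%C = v /\ Cmod (w - a) * Cmod a <= Cmod (v - a * a)).

Lemma Croot_near_spec (a v : C) :
  Cmod (v - a * a) <= Cmod a * Cmod a / 2 ->
  (Croot_near a v * Croot_near a v)%C = v /\
  Cmod (Croot_near a v - a) * Cmod a <= Cmod (v - a * a).
Proof.
  intros Hv. unfold Croot_near. apply epsilon_spec. now apply Croot_near_exists.
Qed.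

(** In [(w - u)(w + u)] the second factor differs from [2 a] by at most [|a|/2 + |a - b| + |b|/2],
    and [|b| <= |a| + |a - b|]. The case [a = b] makes the lifts contract; nearby [a] and [b] give
    continuity of roots. *)
Lemma Croot_diff (a b w u : C) :
  Cmod (w - a) <= Cmod a / 2 -> Cmod (u - b) <= Cmod b / 2 ->
  Cmod (w - u) * (Cmod a - 3 / 2 * Cmod (a - b)) <= Cmod (w * w - u * u).
Proof.
  intros Hw Hu.
  replace (w * w - u * u)%C with ((w - u) * (w + u))%C by ring.
  rewrite Cmod_mult. apply Rmult_le_compat_l; [apply Cmod_ge_0|].
  assert (H1 : Cmod (2 * a) <= Cmod (w + u) + Cmod (2 * a - (w + u)))
    by apply Cmod_triangle_sub.
  replace (2 * a - (w + u))%C with ((a - w) + ((a - b) + (b - u)))%C in H1 by ring.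
  assert (H2 := Cmod_triangle (a - w) ((a - b) + (b - u))).
  assert (H3 := Cmod_triangle (a - b) (b - u)).
  rewrite Cmod_scal in H1 by lra.
  rewrite (Cmod_minus_sym a w) in H2. rewrite (Cmod_minus_sym b u) in H3.
  assert (H4 := Cmod_triangle_sub b a). rewrite (Cmod_minus_sym b a) in H4. lra.
Qed.

(** Closeness of [w] to [f] rules out a jump to the opposite root, by [Croot_diff] centred at [f z]
    and [f y]. *)
Lemma continuous_Croot (f v w : C -> C) (z : C) :
  continuous f z -> continuous v z -> 0 < Cmod (f z) ->
  locally z (fun y => (w y * w y)%C = v y /\ Cmod (w y - f y) <= Cmod (f y) / 2) ->
  continuous w z.
Proof.
  intros Hf Hv Hz Hw. apply continuous_Cmod. intros eps He.
  assert (Hwz := locally_singleton _ _ Hw). destruct Hwz as [Hwz1 Hwz2].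
  apply locally_Cmod in Hw. destruct Hw as (d1 & Hd1 & Hw).
  (* With [|f y - f z| < |f z| / 3], the factor in [Croot_diff] stays above [|f z| / 2]. *)
  assert (HA : 0 < Cmod (f z) / 3) by lra.
  destruct (proj1 (continuous_Cmod _ _) Hf _ HA) as (d2 & Hd2 & Hf').
  assert (HB : 0 < eps * (Cmod (f z) / 2)) by nra.
  destruct (proj1 (continuous_Cmod _ _) Hv _ HB) as (d3 & Hd3 & Hv').
  exists (Rmin d1 (Rmin d2 d3)). split.
  { repeat apply Rmin_pos; assumption. }
  intros y Hy.
  assert (Hy1 : Cmod (y - z) < d1) by (eapply Rlt_le_trans; [exact Hy | apply Rmin_l]).
  assert (Hy' : Cmod (y - z) < Rmin d2 d3)
    by (eapply Rlt_le_trans; [exact Hy | apply Rmin_r]).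
  assert (Hy2 : Cmod (y - z) < d2) by (eapply Rlt_le_trans; [exact Hy' | apply Rmin_l]).
  assert (Hy3 : Cmod (y - z) < d3) by (eapply Rlt_le_trans; [exact Hy' | apply Rmin_r]).
  destruct (Hw y Hy1) as [Hwy1 Hwy2].
  specialize (Hf' y Hy2). specialize (Hv' y Hy3).
  assert (H := Croot_diff _ _ _ _ Hwz2 Hwy2).
  rewrite Hwz1, Hwy1, (Cmod_minus_sym (f z)), (Cmod_minus_sym (w z)),
    (Cmod_minus_sym (v z)) in H.
  assert (H0 := Cmod_ge_0 (w y - w z)).
  apply Rmult_lt_reg_r with (Cmod (f z) / 2); [lra|].
  eapply Rle_lt_trans; [|exact Hv']. eapply Rle_trans; [|exact H].
  apply Rmult_le_compat_l; lra.
Qed.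

(** * Limits of sequences with geometric increments *)

Lemma geometric_limit_R (a : nat -> R) :
  (forall n, Rabs (a (S n) - a n) <= (1 / 2) ^ n) ->
  exists l, forall n, Rabs (a n - l) <= 2 * (1 / 2) ^ n.
Proof.
  intros Ha.
  assert (Hp : forall n, 0 < (1 / 2) ^ n) by (intros; apply pow_lt; lra).
  (* Keeping the exact partial geometric sum on the right lets the induction on [k] close. *)
  assert (Hk : forall k n, Rabs (a (n + k)%nat - a n) <= 2 * (1 / 2) ^ n - 2 * (1 / 2) ^ (n + k)).
  { induction k; intros n.
    - rewrite Nat.add_0_r, Rminus_diag, Rabs_R0. specialize (Hp n). lra.
    - rewrite <- plus_n_Sm.
      replace (a (S (n + k)) - a n)
        with ((a (S (n + k)) - a (n + k)%nat) + (a (n + k)%nat - a n)) by ring.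
      eapply Rle_trans; [apply Rabs_triang|].
      specialize (IHk n). specialize (Ha (n + k)%nat).
      rewrite <- tech_pow_Rmult. lra. }
  assert (Hc : Cauchy_crit a).
  { intros eps He.
    destruct (pow_lt_1_zero (1 / 2)) with (y := eps / 4) as (N & HN);
      [rewrite Rabs_pos_eq; lra | lra |].
    exists N. intros n m Hn Hm. unfold Rdist.
    assert (E : (1 / 2) ^ N < eps / 4).
    { specialize (HN N (le_n N)). rewrite Rabs_pos_eq in HN; [exact HN|].
      specialize (Hp N). lra. }
    assert (Hd : forall p, (p >= N)%nat -> Rabs (a p - a N) <= 2 * (1 / 2) ^ N).
    { intros p Hq. replace p with (N + (p - N))%nat by lia.
      eapply Rle_trans; [apply Hk|]. specialize (Hp (N + (p - N))%nat). lra. }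
    replace (a n - a m) with ((a n - a N) - (a m - a N)) by ring.
    eapply Rle_lt_trans; [apply Rabs_triang|]. rewrite Rabs_Ropp.
    specialize (Hd n Hn) as Hdn. specialize (Hd m Hm) as Hdm. lra. }
  destruct (Rcomplete.R_complete a Hc) as (l & Hl). exists l. intros n.
  apply le_epsilon. intros eps He. destruct (Hl eps He) as (N & HN).
  specialize (HN (n + N)%nat ltac:(lia)). unfold Rdist in HN.
  specialize (Hk N n). specialize (Hp (n + N)%nat).
  replace (a n - l) with (- (a (n + N)%nat - a n) + (a (n + N)%nat - l)) by ring.
  eapply Rle_trans; [apply Rabs_triang|]. rewrite Rabs_Ropp. lra.
Qed.

Lemma geometric_limit_C (a : nat -> C) :
  (forall n, Cmod (a (S n) - a n) <= (1 / 2) ^ n) ->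
  exists l, forall n, Cmod (a n - l) <= 4 * (1 / 2) ^ n.
Proof.
  intros Ha.
  destruct (geometric_limit_R (fun n => fst (a n))) as (x & Hx).
  { intros n. eapply Rle_trans; [apply (Rabs_fst_le (a (S n) - a n))|apply Ha]. }
  destruct (geometric_limit_R (fun n => snd (a n))) as (y & Hy).
  { intros n. eapply Rle_trans; [apply (Rabs_snd_le (a (S n) - a n))|apply Ha]. }
  exists (x, y). intros n. eapply Rle_trans; [apply Cmod_le_abs|].
  specialize (Hx n). specialize (Hy n). simpl in *.
  unfold Rminus in *. lra.
Qed.


(** * The stretch [h] at angle [0] and the maps [f_c] *)

Lemma h_th0 (K : R) (z : C) : h K 0 z = (K * fst z, snd z).
Proof.
  unfold h, cis. rewrite Rmult_0_r, cos_0, sin_0. apply Ceq; simpl; field.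
Qed.

Lemma h_scal (K t : R) (z : C) : h K 0 (RtoC t * z) = (RtoC t * h K 0 z)%C.
Proof. rewrite !h_th0. apply Ceq; simpl; ring. Qed.

Lemma h_minus (K : R) (z w : C) : h K 0 (z - w) = (h K 0 z - h K 0 w)%C.
Proof. rewrite !h_th0. apply Ceq; simpl; ring. Qed.

Lemma Cmod_h_ge (K : R) (z : C) : 1 <= K -> Cmod z <= Cmod (h K 0 z).
Proof.
  intros HK. rewrite h_th0. unfold Cmod; simpl. apply sqrt_le_1_alt.
  assert (0 <= fst z * fst z) by nra. assert (1 <= K * K) by nra. nra.
Qed.

Lemma Cmod_h_le (K : R) (z : C) : 1 <= K -> Cmod (h K 0 z) <= K * Cmod z.
Proof.
  intros HK. apply Rsqr_incr_0.
  - unfold Rsqr. rewrite Cmod_sqr, h_th0.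
    replace (K * Cmod z * (K * Cmod z)) with (K * K * (Cmod z * Cmod z)) by ring.
    rewrite Cmod_sqr. simpl.
    assert (0 <= snd z * snd z) by nra. assert (1 <= K * K) by nra. nra.
  - apply Cmod_ge_0.
  - generalize (Cmod_ge_0 z). nra.
Qed.

Definition hinv (K : R) (w : C) : C := (fst w / K, snd w).

Lemma h_hinv (K : R) (w : C) : K <> 0 -> h K 0 (hinv K w) = w.
Proof. intros HK. rewrite h_th0. apply Ceq; simpl; field; exact HK. Qed.

Lemma hinv_h (K : R) (w : C) : K <> 0 -> hinv K (h K 0 w) = w.
Proof. intros HK. rewrite h_th0. apply Ceq; simpl; field; exact HK. Qed.

Lemma hinv_minus (K : R) (z w : C) : (hinv K z - hinv K w)%C = hinv K (z - w).
Proof. apply Ceq; simpl; unfold Rdiv; ring. Qed.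

Lemma Cmod_hinv_le (K : R) (w : C) : 1 <= K -> Cmod (hinv K w) <= Cmod w.
Proof.
  intros HK. rewrite <- (h_hinv K w) at 2 by lra. now apply Cmod_h_ge.
Qed.

Lemma continuous_h (K : R) (z : C) : continuous (h K 0) z.
Proof.
  apply continuous_ext with (fun w : C => (K * fst w, snd w)).
  { intros w. now rewrite h_th0. }
  apply continuous_pair; simpl.
  - apply (continuous_scal_r K (fun w : C => fst w)). apply continuous_fst_C.
  - apply continuous_snd_C.
Qed.

Lemma continuous_hinv (K : R) (z : C) : continuous (hinv K) z.
Proof.
  apply continuous_pair; simpl.
  - apply (continuous_mult (fun w : C => fst w) (fun _ => / K)).
    apply continuous_fst_C. apply continuous_const.
  - apply continuous_snd_C.
Qed.

Lemma continuous_fc (K : R) (c z : C) : continuous (fc K 0 c) z.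
Proof.
  apply continuous_ext
    with (fun w : C => (K * fst w * (K * fst w) - snd w * snd w + fst c,
                        K * fst w * snd w + snd w * (K * fst w) + snd c)).
  { intros w. unfold fc. rewrite h_th0. apply Ceq; simpl; ring. }
  assert (Hk : continuous (fun w : C => K * fst w) z).
  { apply (continuous_scal_r K (fun w : C => fst w)). apply continuous_fst_C. }
  assert (Hs := continuous_snd_C z).
  apply continuous_pair; simpl.
  - apply (continuous_plus (fun w : C => K * fst w * (K * fst w) - snd w * snd w)
             (fun _ => fst c)); [|apply continuous_const].
    apply (continuous_minus (fun w : C => K * fst w * (K * fst w))
             (fun w : C => snd w * snd w)).
    + now apply (continuous_mult (fun w : C => K * fst w) (fun w : C => K * fst w)).
    + now apply (continuous_mult (fun w : C => snd w) (fun w : C => snd w)).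
  - apply (continuous_plus (fun w : C => K * fst w * snd w + snd w * (K * fst w))
             (fun _ => snd c)); [|apply continuous_const].
    apply (continuous_plus (fun w : C => K * fst w * snd w)
             (fun w : C => snd w * (K * fst w))).
    + now apply (continuous_mult (fun w : C => K * fst w) (fun w : C => snd w)).
    + now apply (continuous_mult (fun w : C => snd w) (fun w : C => K * fst w)).
Qed.

Lemma fiter_S (K th : R) (c : C) (n : nat) (z : C) :
  fiter K th c (S n) z = fc K th c (fiter K th c n z).
Proof. reflexivity. Qed.

Lemma fiter_fc (K th : R) (c : C) (n : nat) (z : C) :
  fiter K th c n (fc K th c z) = fiter K th c (S n) z.
Proof.
  induction n; [reflexivity|]. rewrite fiter_S, IHn. reflexivity.
Qed.

Lemma fiter_add (K th : R) (c : C) (m n : nat) (z : C) :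
  fiter K th c (m + n) z = fiter K th c m (fiter K th c n z).
Proof. induction m; [reflexivity|]. simpl. now f_equal. Qed.

Lemma continuous_fiter (K : R) (c : C) (n : nat) (z : C) :
  continuous (fiter K 0 c n) z.
Proof.
  induction n.
  - apply continuous_id.
  - apply (continuous_comp (fiter K 0 c n) (fc K 0 c)); [exact IHn|].
    apply continuous_fc.
Qed.

(** [|f_c z| >= |h z|^2 - |c| >= |z|^2 - |c|], which is at least [2 |z|] as soon as [|z| > |c| + 3].
    This escape radius is also the radius of the domain of the Boettcher coordinate below. *)
Lemma Cmod_fc_ge (K : R) (c z : C) :
  1 <= K -> Cmod c + 3 < Cmod z -> 2 * Cmod z <= Cmod (fc K 0 c z).
Proof.
  intros HK Hz. assert (H := Cmod_triangle_sub (h K 0 z * h K 0 z) (fc K 0 c z)).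
  unfold fc in *.
  replace (h K 0 z * h K 0 z - (h K 0 z * h K 0 z + c))%C with (- c)%C in H by ring.
  rewrite Cmod_opp, Cmod_mult in H.
  assert (H1 := Cmod_h_ge K z HK). assert (H2 := Cmod_ge_0 c). nra.
Qed.

Lemma Cmod_fiter_ge (K : R) (c z : C) (n : nat) :
  1 <= K -> Cmod c + 3 < Cmod z ->
  Cmod c + 3 < Cmod (fiter K 0 c n z) /\ INR n < Cmod (fiter K 0 c n z).
Proof.
  intros HK Hz. assert (H0 := Cmod_ge_0 c). induction n.
  - simpl. split; lra.
  - rewrite fiter_S, S_INR. destruct IHn as [H1 H2].
    assert (H := Cmod_fc_ge K c _ HK H1). split; lra.
Qed.

Lemma escaping_fiter (K : R) (c z : C) (n : nat) :
  escaping K 0 c (fiter K 0 c n z) <-> escaping K 0 c z.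
Proof.
  unfold escaping.
  rewrite (is_lim_seq_incr_n (fun k => Cmod (fiter K 0 c k z)) n).
  split; apply is_lim_seq_ext; intros k; now rewrite fiter_add.
Qed.

Lemma escaping_fc (K : R) (c z : C) :
  escaping K 0 c (fc K 0 c z) <-> escaping K 0 c z.
Proof. exact (escaping_fiter K c z 1). Qed.

Lemma escaping_large (K : R) (c z : C) :
  1 <= K -> Cmod c + 3 < Cmod z -> escaping K 0 c z.
Proof.
  intros HK Hz. apply is_lim_seq_le_p_loc with INR; [|apply is_lim_seq_INR].
  exists 0%nat. intros n _. left. now apply Cmod_fiter_ge.
Qed.

Lemma escaping_reaches (K th : R) (c z : C) (r : R) :
  escaping K th c z -> exists N, forall n, (N <= n)%nat -> r < Cmod (fiter K th c n z).
Proof.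
  intros H. apply is_lim_seq_spec in H. destruct (H r) as (N & HN). now exists N.
Qed.

(** Some iterate of [z] has modulus above [|c| + 4]; by continuity that iterate of any nearby point
    still exceeds the escape radius. *)
Lemma escaping_open (K : R) (c z : C) :
  1 <= K -> escaping K 0 c z -> locally z (escaping K 0 c).
Proof.
  intros HK Hz. destruct (escaping_reaches _ _ _ _ (Cmod c + 4) Hz) as (n & Hn).
  specialize (Hn n (le_n n)).
  destruct (proj1 (continuous_Cmod _ _) (continuous_fiter K c n z) 1 Rlt_0_1)
    as (d & Hd & H).
  apply locally_Cmod. exists d. split; [exact Hd|]. intros y Hy.
  apply (escaping_fiter K c y n). apply escaping_large; [exact HK|].
  specialize (H y Hy). rewrite Cmod_minus_sym in H.
  assert (H' := Cmod_triangle_sub (fiter K 0 c n z) (fiter K 0 c n y)). lra.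
Qed.

(** * The escaping set of [f_0] on rays *)

Lemma fc0_scal (K t : R) (z : C) :
  fc K 0 0 (RtoC t * z) = (RtoC (t * t) * fc K 0 0 z)%C.
Proof. unfold fc. rewrite h_scal. rewrite RtoC_mult. ring. Qed.

Lemma fiter0_scal (K t : R) (n : nat) (z : C) :
  fiter K 0 0 n (RtoC t * z) = (RtoC (t ^ (2 ^ n)) * fiter K 0 0 n z)%C.
Proof.
  induction n.
  - simpl. now rewrite Rmult_1_r.
  - rewrite !fiter_S, IHn, fc0_scal. do 2 f_equal.
    rewrite <- pow_add. f_equal. simpl. lia.
Qed.

(** Since [|h z| <= K |z|], the map [f_0] at most squares the quantity [K^2 |z|], which therefore
    stays below 1. *)
Lemma bounded0_small (K : R) (z : C) :
  1 <= K -> K * K * Cmod z < 1 -> ~ escaping K 0 0 z.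
Proof.
  intros HK Hz He.
  assert (H : forall n, K * K * Cmod (fiter K 0 0 n z) < 1).
  { induction n; [exact Hz|]. rewrite fiter_S. unfold fc.
    rewrite Cplus_0_r, Cmod_mult.
    assert (H1 := Cmod_h_le K (fiter K 0 0 n z) HK).
    assert (H2 := Cmod_ge_0 (h K 0 (fiter K 0 0 n z))).
    assert (H3 := Cmod_ge_0 (fiter K 0 0 n z)).
    assert (H4 : Cmod (h K 0 (fiter K 0 0 n z)) * Cmod (h K 0 (fiter K 0 0 n z))
      <= (K * Cmod (fiter K 0 0 n z)) * (K * Cmod (fiter K 0 0 n z))) by nra.
    assert (H5 : 0 <= K * K * Cmod (fiter K 0 0 n z)) by (apply Rmult_le_pos; nra).
    assert (H6 : K * K * (K * Cmod (fiter K 0 0 n z) * (K * Cmod (fiter K 0 0 n z))) < 1) by nra.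
    assert (0 < K * K) by nra. nra. }
  destruct (escaping_reaches _ _ _ _ 1 He) as (n & Hn).
  specialize (Hn n (le_n n)). specialize (H n). nra.
Qed.

Lemma escaping0_scal (K t : R) (z : C) :
  1 <= t -> escaping K 0 0 z -> escaping K 0 0 (RtoC t * z).
Proof.
  intros Ht Hz.
  apply is_lim_seq_le_p_loc with (fun n => Cmod (fiter K 0 0 n z)); [|exact Hz].
  exists 0%nat. intros n _. rewrite fiter0_scal.
  assert (H : 1 <= t ^ 2 ^ n) by now apply pow_R1_Rle.
  rewrite Cmod_scal by lra. generalize (Cmod_ge_0 (fiter K 0 0 n z)). nra.
Qed.

(** The orbit of [z] never exceeds the escape radius 3, and that of [t z] carries the extra factor
    [t^(2^n)]. It thus enters the disc of [bounded0_small], and by continuity so do the orbits of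
    nearby points. *)
Lemma not_escaping0_scal (K t : R) (z : C) :
  1 <= K -> 0 <= t < 1 -> ~ escaping K 0 0 z ->
  locally (RtoC t * z)%C (fun y => ~ escaping K 0 0 y).
Proof.
  intros HK Ht Hz.
  assert (Hb : forall n, Cmod (fiter K 0 0 n z) <= 3).
  { intros n. apply Rnot_lt_le. intros H. apply Hz.
    apply (escaping_fiter K 0 z n). apply escaping_large; [exact HK|].
    rewrite Cmod_0. lra. }
  (* Below this value of [t^(2^n)], [K^2] times the modulus is at most [3 K^2 / (3 K^2 + 1) < 1]. *)
  assert (HK3 : 0 < / (3 * (K * K) + 1)) by (apply Rinv_0_lt_compat; nra).
  destruct (pow_lt_1_zero t) with (y := / (3 * (K * K) + 1)) as (n & Hn);
    [rewrite Rabs_pos_eq; lra | exact HK3 |].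
  specialize (Hn (2 ^ n)%nat).
  assert (Hle : (n <= 2 ^ n)%nat).
  { apply Nat.lt_le_incl, Nat.pow_gt_lin_r. lia. }
  specialize (Hn Hle).
  assert (Hp : 0 <= t ^ 2 ^ n) by (apply pow_le; lra).
  rewrite Rabs_pos_eq in Hn by exact Hp.
  assert (Hsmall : K * K * Cmod (fiter K 0 0 n (RtoC t * z)) < 1).
  { rewrite fiter0_scal, Cmod_scal by exact Hp. specialize (Hb n).
    assert (H0 := Cmod_ge_0 (fiter K 0 0 n z)).
    assert (t ^ 2 ^ n * (3 * (K * K) + 1) < 1).
    { apply Rmult_lt_reg_r with (/ (3 * (K * K) + 1)); [exact HK3|].
      rewrite Rmult_assoc, Rinv_r by nra. lra. }
    assert (t ^ 2 ^ n * Cmod (fiter K 0 0 n z) <= t ^ 2 ^ n * 3) by nra.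
    assert (1 <= K * K) by nra. nra. }
  set (e := 1 - K * K * Cmod (fiter K 0 0 n (RtoC t * z))) in *.
  assert (He : 0 < e / (K * K)) by (apply Rdiv_lt_0_compat; unfold e; nra).
  destruct (proj1 (continuous_Cmod _ _) (continuous_fiter K 0 n (RtoC t * z)) _ He)
    as (d & Hd & H).
  apply locally_Cmod. exists d. split; [exact Hd|]. intros y Hy Hy'.
  apply (escaping_fiter K 0 y n) in Hy'. revert Hy'.
  apply bounded0_small; [exact HK|].
  specialize (H y Hy).
  assert (H' := Cmod_triangle_sub (fiter K 0 0 n y) (fiter K 0 0 n (RtoC t * z))).
  assert (H'' : Cmod (fiter K 0 0 n y - fiter K 0 0 n (RtoC t * z)) * (K * K) < e).
  { replace e with (e / (K * K) * (K * K)) by (field; lra).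
    apply Rmult_lt_compat_r; [nra | exact H]. }
  assert (0 < K * K) by nra. unfold e in *. nra.
Qed.

(** The ray through [w] meets the boundary of [I(f_0)] at [tau w], so [- ln tau] is [G0] at an
    escaping [w]. Measuring in multiples of [w] keeps arguments out of the dynamics. *)
Definition ray_threshold (K : R) (w : C) (tau : R) : Prop :=
  0 < tau /\
  (forall t, tau < t -> escaping K 0 0 (RtoC t * w)) /\
  (forall t, 0 <= t < tau -> ~ escaping K 0 0 (RtoC t * w)).

(** The threshold is the supremum of the non-escaping [t]: this set is bounded by the escape radius,
    contains the positive [t1] by [bounded0_small], and is an interval by [escaping0_scal]. *)
Lemma ray_threshold_exists (K : R) (w : C) :
  1 <= K -> w <> 0%C -> exists tau, ray_threshold K w tau.
Proof.
  intros HK Hw. apply Cmod_gt_0 in Hw.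
  set (E := fun t => 0 <= t /\ ~ escaping K 0 0 (RtoC t * w)).
  assert (Hb : bound E).
  { exists (3 / Cmod w). intros t [Ht H]. apply Rnot_lt_le. intros Hlt. apply H.
    apply escaping_large; [exact HK|]. rewrite Cmod_0, Cmod_scal by exact Ht.
    apply Rmult_lt_compat_r with (r := Cmod w) in Hlt; [|exact Hw].
    unfold Rdiv in Hlt. rewrite Rmult_assoc, Rinv_l in Hlt; lra. }
  set (t1 := / (2 * (K * K) * Cmod w)).
  assert (HKw : 0 < 2 * (K * K) * Cmod w) by (apply Rmult_lt_0_compat; nra).
  assert (Ht1 : 0 < t1) by now apply Rinv_0_lt_compat.
  assert (HE1 : E t1).
  { split; [lra|]. apply bounded0_small; [exact HK|]. rewrite Cmod_scal by lra.
    replace (K * K * (t1 * Cmod w)) with (1 / 2); [lra|].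
    unfold t1. field. split; lra. }
  destruct (completeness E Hb) as (tau & Hub & Hlub); [now exists t1|].
  exists tau. split; [|split].
  - specialize (Hub t1 HE1). lra.
  - intros t Ht. apply NNPP. intros H. assert (E t).
    { split; [|exact H]. specialize (Hub t1 HE1). lra. }
    specialize (Hub t H0). lra.
  - intros t Ht He. assert (tau <= t); [|lra]. apply Hlub. intros s [Hs Hs'].
    apply Rnot_lt_le. intros Hlt. apply Hs'.
    (* The comparison of [s w] with [t w] divides by [t]; the origin is treated apart, being fixed
       by [f_0]. *)
    destruct (Req_dec t 0) as [->|Hne].
    { exfalso. revert He. apply bounded0_small; [exact HK|].
      rewrite Cmult_0_l, Cmod_0. lra. }
    replace (RtoC s * w)%C with (RtoC (s / t) * (RtoC t * w))%C.
    + apply escaping0_scal; [|exact He]. apply Rmult_le_reg_r with t; [lra|].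
      unfold Rdiv. rewrite Rmult_assoc, Rinv_l; lra.
    + rewrite Cmult_assoc, <- RtoC_mult. do 2 f_equal. field. exact Hne.
Qed.

(** [t f_0 w = f_0 (sqrt t w)] for [t >= 0], and a point escapes exactly when its image does. *)
Lemma ray_threshold_fc (K : R) (w : C) (tau : R) :
  ray_threshold K w tau -> ray_threshold K (fc K 0 0 w) (tau * tau).
Proof.
  intros (H0 & H1 & H2). split; [nra|].
  assert (Hsq : forall t, 0 <= t ->
    (escaping K 0 0 (RtoC t * fc K 0 0 w) <-> escaping K 0 0 (RtoC (sqrt t) * w))).
  { intros t Ht. rewrite <- (sqrt_sqrt t Ht) at 1.
    rewrite <- fc0_scal. apply escaping_fc. }
  split.
  - intros t Ht. apply Hsq; [nra|]. apply H1.
    rewrite <- (sqrt_square tau) by lra. apply sqrt_lt_1_alt. nra.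
  - intros t Ht. rewrite Hsq by lra. apply H2. split; [apply sqrt_pos|].
    rewrite <- (sqrt_square tau) by lra. apply sqrt_lt_1_alt. lra.
Qed.

Lemma continuous_ray (w : C) (t : R) : continuous (fun s : R => (RtoC s * w)%C) t.
Proof.
  apply continuous_ext with (fun s => (s * fst w, s * snd w)).
  { intros s. apply Ceq; simpl; ring. }
  apply continuous_pair; simpl.
  - apply (continuous_mult (fun s : R => s) (fun _ => fst w)).
    apply continuous_id. apply continuous_const.
  - apply (continuous_mult (fun s : R => s) (fun _ => snd w)).
    apply continuous_id. apply continuous_const.
Qed.

(** Beyond [tau] the points are interior to the escaping set. Before [tau] they are interior to its
    complement, being proper contractions of the non-escaping midpoint [s w]. At [tau] both kinds
    accumulate along the ray. *)
Lemma boundary_ray (K : R) (w : C) (tau t : R) :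
  1 <= K -> ray_threshold K w tau -> 0 <= t ->
  (boundary (escaping K 0 0) (RtoC t * w)%C <-> t = tau).
Proof.
  intros HK (H0 & H1 & H2) Ht. split.
  - intros Hb. destruct (Rtotal_order t tau) as [Hlt | [Heq | Hgt]]; [|exact Heq|].
    + exfalso. set (s := (t + tau) / 2).
      assert (Hs : ~ escaping K 0 0 (RtoC s * w)) by (apply H2; unfold s; lra).
      apply (not_escaping0_scal K (t / s)) in Hs; [|exact HK|].
      * replace (RtoC (t / s) * (RtoC s * w))%C with (RtoC t * w)%C in Hs.
        { destruct (Hb _ Hs) as ((x & Hx & Hx') & _). now apply Hx. }
        rewrite Cmult_assoc, <- RtoC_mult. do 2 f_equal. field. unfold s; lra.
      * assert (Hs0 : 0 < s) by (unfold s; lra). split.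
        { apply Rmult_le_pos; [exact Ht|]. left. now apply Rinv_0_lt_compat. }
        apply Rmult_lt_reg_r with s; [exact Hs0|]. unfold Rdiv.
        rewrite Rmult_assoc, Rinv_l by lra. unfold s. lra.
    + exfalso. destruct (Hb _ (escaping_open K 0 _ HK (H1 t Hgt)))
        as (_ & (y & Hy & Hy')). contradiction.
  - intros -> V HV. apply (continuous_ray w tau) in HV.
    destruct HV as [d Hd]. assert (Hd0 := cond_pos d). split.
    + exists (RtoC (tau + d / 2) * w)%C. split; [|apply H1; lra].
      apply Hd. unfold ball; simpl. unfold AbsRing_ball, abs, minus, plus, opp; simpl.
      rewrite Rabs_pos_eq; lra.
    (* The cap by [tau] keeps [tau - e] nonnegative, as the threshold property requires. *)
    + set (e := Rmin (d / 2) tau).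
      assert (0 < e) by (apply Rmin_pos; lra).
      assert (e <= d / 2) by apply Rmin_l. assert (e <= tau) by apply Rmin_r.
      exists (RtoC (tau - e) * w)%C. split; [|apply H2; lra].
      apply Hd. unfold ball; simpl. unfold AbsRing_ball, abs, minus, plus, opp; simpl.
      rewrite Rabs_left; lra.
Qed.

(** * Arguments, and [G0] in terms of ray thresholds *)

Lemma Carg_spec (z : C) :
  - PI < Carg z <= PI /\ z = (RtoC (Cmod z) * cis (Carg z))%C.
Proof.
  unfold Carg. apply epsilon_spec.
  assert (HPI := PI_RGT_0).
  destruct (Ceq_dec z 0) as [->|Hz].
  { exists 0. split; [lra|]. rewrite Cmod_0. ring. }
  apply Cmod_gt_0 in Hz. set (m := Cmod z) in *.
  assert (Hm : m * m = fst z * fst z + snd z * snd z) by apply Cmod_sqr.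
  set (a := fst z / m). set (b := snd z / m).
  assert (Hab : a * a + b * b = 1).
  { unfold a, b. replace (fst z / m * (fst z / m) + snd z / m * (snd z / m))
      with ((fst z * fst z + snd z * snd z) / (m * m)) by (field; lra).
    rewrite <- Hm. field. lra. }
  assert (Ha : -1 <= a <= 1) by nra.
  assert (Hcos : cos (acos a) = a) by now apply cos_acos.
  assert (Hsin : sin (acos a) = Rabs b).
  { rewrite sin_acos by exact Ha. rewrite <- sqrt_Rsqr_abs. f_equal.
    unfold Rsqr. lra. }
  assert (Hbd := acos_bound a).
  assert (Hz1 : fst z = m * a) by (unfold a; field; lra).
  assert (Hz2 : snd z = m * b) by (unfold b; field; lra).
  destruct (Rle_lt_dec 0 b) as [Hb | Hb].
  - exists (acos a). split; [lra|].
    unfold cis. rewrite Hcos, Hsin, Rabs_pos_eq by exact Hb.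
    apply Ceq; simpl; lra.
  - exists (- acos a). split.
    (* The excluded angle [- PI] would mean [a = -1], hence [b = 0], against [b < 0]. *)
    + split; [|lra]. destruct (Req_dec (acos a) PI) as [E|E]; [|lra].
      exfalso. rewrite E, cos_PI in Hcos. nra.
    + unfold cis. rewrite cos_neg, sin_neg, Hcos, Hsin, Rabs_left by exact Hb.
      apply Ceq; simpl; lra.
Qed.

(** The point picked by [epsilon] is a nonnegative multiple of [w] on the boundary, and
    [boundary_ray] leaves only one such multiple. *)
Lemma ray_point_eq (K : R) (w : C) (tau : R) :
  1 <= K -> w <> 0%C -> ray_threshold K w tau ->
  ray_point K 0 (Carg w) = (RtoC tau * w)%C.
Proof.
  intros HK Hw Htau. destruct (Carg_spec w) as [_ Harg].
  apply Cmod_gt_0 in Hw.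
  assert (Hex : exists p, ray (Carg w) p /\ boundary (escaping K 0 0) p).
  { exists (RtoC tau * w)%C. split.
    - exists (tau * Cmod w). split; [destruct Htau; nra|].
      rewrite Harg at 1. rewrite RtoC_mult. ring.
    - apply (boundary_ray K w tau tau); trivial. destruct Htau; lra. }
  apply (epsilon_spec (inhabits (RtoC 0))) in Hex.
  change (ray (Carg w) (ray_point K 0 (Carg w)) /\
          boundary (escaping K 0 0) (ray_point K 0 (Carg w))) in Hex.
  destruct Hex as [(t & Ht & Hp) Hb].
  assert (E : ray_point K 0 (Carg w) = (RtoC (t / Cmod w) * w)%C).
  { rewrite Hp. rewrite Harg at 3. rewrite Cmult_assoc, <- RtoC_mult.
    do 2 f_equal. field. lra. }
  rewrite E in Hb |- *. apply (boundary_ray K w tau) in Hb; trivial.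
  - now rewrite Hb.
  - apply Rmult_le_pos; [exact Ht|]. left. now apply Rinv_0_lt_compat.
Qed.

Lemma G0_threshold (K : R) (w : C) (tau : R) :
  1 <= K -> ray_threshold K w tau -> escaping K 0 0 w -> G0 K 0 w = - ln tau.
Proof.
  intros HK Htau He. unfold G0.
  destruct (excluded_middle_informative _) as [_|]; [|contradiction].
  assert (Hw : w <> 0%C).
  { intros ->. revert He. apply bounded0_small; [exact HK|]. rewrite Cmod_0. lra. }
  rewrite (ray_point_eq K w tau) by assumption. apply Cmod_gt_0 in Hw.
  destruct Htau as [H0 _]. rewrite Cmod_scal by lra.
  rewrite <- ln_Rinv by exact H0. f_equal. field. lra.
Qed.

Lemma G0_fc (K : R) (w : C) : 1 <= K -> G0 K 0 (fc K 0 0 w) = 2 * G0 K 0 w.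
Proof.
  intros HK. destruct (excluded_middle_informative (escaping K 0 0 w)) as [He|He].
  - assert (Hw : w <> 0%C).
    { intros ->. revert He. apply bounded0_small; [exact HK|]. rewrite Cmod_0. lra. }
    destruct (ray_threshold_exists K w HK Hw) as (tau & Htau).
    rewrite (G0_threshold K w tau) by assumption.
    rewrite (G0_threshold K _ (tau * tau)).
    + destruct Htau. rewrite ln_mult by assumption. ring.
    + exact HK.
    + now apply ray_threshold_fc.
    + now apply escaping_fc.
  - assert (He' : ~ escaping K 0 0 (fc K 0 0 w)) by now rewrite escaping_fc.
    unfold G0.
    destruct (excluded_middle_informative (escaping K 0 0 w)); [contradiction|].
    destruct (excluded_middle_informative _); [contradiction|]. ring.
Qed.


(** * Existence of the Boettcher coordinate and of the Green function *)

Fixpoint boettcher_approx (K : R) (c : C) (k : nat) (z : C) : C :=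
  match k with
  | O => z
  | S k => hinv K (Croot_near (h K 0 z) (boettcher_approx K c k (fc K 0 c z)))
  end.

Section Boettcher.

Variables (K : R) (c : C).
Hypothesis HK : 1 <= K.

Let r := Cmod c + 3.
Let psi := boettcher_approx K c.

Lemma fc_large (z : C) : r < Cmod z -> r < Cmod (fc K 0 c z).
Proof.
  intros Hz. assert (H := Cmod_fc_ge K c z HK Hz). generalize (Cmod_ge_0 z). lra.
Qed.

(** [v - a^2 = (psi k (f_c z) - f_c z) + c], while [|a| >= |z| > |c| + 3] makes [|a|^2 / 2] exceed
    [1 + |c|]. This is the precondition of [Croot_near_spec]. *)
Lemma root_target_close (k : nat) (z : C) :
  r < Cmod z ->
  Cmod (psi k (fc K 0 c z) - fc K 0 c z) <= 1 ->
  let v := psi k (fc K 0 c z) in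
  let a := h K 0 z in
  Cmod (v - a * a) <= 1 + Cmod c /\ Cmod (v - a * a) <= Cmod a * Cmod a / 2.
Proof.
  intros Hz Hk v a.
  assert (H1 : Cmod (v - a * a) <= 1 + Cmod c).
  { replace (v - a * a)%C with ((psi k (fc K 0 c z) - fc K 0 c z) + c)%C
      by (unfold v, a, fc; ring).
    eapply Rle_trans; [apply Cmod_triangle|]. lra. }
  split; [exact H1|].
  assert (Ha := Cmod_h_ge K z HK). fold a in Ha.
  assert (Hc := Cmod_ge_0 c). unfold r in *. nra.
Qed.

(** The two bounds are proved together: the second feeds the induction through [root_target_close],
    the first yields [psi k z = z + o(1)]. *)
Lemma boettcher_approx_close (k : nat) (z : C) :
  r < Cmod z -> Cmod (psi k z - z) * Cmod z <= 1 + Cmod c /\ Cmod (psi k z - z) <= 1.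
Proof.
  revert z. assert (Hc := Cmod_ge_0 c). induction k; intros z Hz.
  - change (psi 0 z) with z. replace (z - z)%C with (RtoC 0) by ring. rewrite Cmod_0. lra.
  - destruct (root_target_close k z Hz) as [H1 H2].
    { apply IHk. now apply fc_large. }
    destruct (Croot_near_spec _ _ H2) as [_ H3].
    assert (H4 : Cmod (psi (S k) z - z) * Cmod z <= 1 + Cmod c).
    { eapply Rle_trans; [|exact H1]. eapply Rle_trans; [|exact H3].
      apply Rmult_le_compat; try apply Cmod_ge_0; [|now apply Cmod_h_ge].
      rewrite <- (hinv_h K z) at 2 by lra.
      unfold psi. simpl. rewrite hinv_minus. now apply Cmod_hinv_le. }
    split; [exact H4|]. apply Rmult_le_reg_r with (Cmod z); unfold r in *; lra.
Qed.

Lemma boettcher_root (k : nat) (z : C) :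
  r < Cmod z ->
  let w := h K 0 (psi (S k) z) in
  (w * w)%C = psi k (fc K 0 c z) /\ Cmod (w - h K 0 z) <= Cmod (h K 0 z) / 2.
Proof.
  intros Hz w.
  destruct (root_target_close k z Hz) as [H1 H2].
  { apply boettcher_approx_close. now apply fc_large. }
  destruct (Croot_near_spec _ _ H2) as [H3 H4].
  unfold w, psi. simpl. rewrite h_hinv by lra. split; [exact H3|].
  assert (Ha := Cmod_h_ge K z HK). assert (Hc := Cmod_ge_0 c).
  apply Rmult_le_reg_r with (Cmod (h K 0 z)); unfold r in *; [lra|].
  eapply Rle_trans; [exact H4|]. lra.
Qed.

Lemma locally_large (z : C) : r < Cmod z -> locally z (fun y => r < Cmod y).
Proof.
  intros Hz. apply locally_Cmod. exists (Cmod z - r). split; [lra|].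
  intros y Hy. assert (H := Cmod_triangle_sub z y). rewrite Cmod_minus_sym in H. lra.
Qed.

Lemma boettcher_approx_continuous (k : nat) (z : C) :
  r < Cmod z -> continuous (psi k) z.
Proof.
  revert z. induction k; intros z Hz; [apply continuous_id|].
  apply continuous_ext with (fun y => hinv K (h K 0 (psi (S k) y))).
  { intros y. apply hinv_h. lra. }
  apply (continuous_comp (fun y => h K 0 (psi (S k) y)) (hinv K));
    [|apply continuous_hinv].
  apply continuous_Croot with (h K 0) (fun y => psi k (fc K 0 c y)).
  - apply continuous_h.
  - apply (continuous_comp (fc K 0 c) (psi k)); [apply continuous_fc|].
    apply IHk. now apply fc_large.
  - assert (H := Cmod_h_ge K z HK). assert (Hc := Cmod_ge_0 c). unfold r in *. lra.
  - generalize (locally_large z Hz). apply filter_imp.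
    intros y Hy. now apply boettcher_root.
Qed.

(** Both roots lie near the same [h z], so [Croot_diff] with [a = b] divides the previous
    difference, taken at [f_c z], by [|h z| > 2]. *)
Lemma boettcher_approx_step (k : nat) (z : C) :
  r < Cmod z -> Cmod (psi (S k) z - psi k z) <= (1 / 2) ^ k.
Proof.
  revert z. induction k; intros z Hz.
  - simpl ((1 / 2) ^ 0). now apply boettcher_approx_close.
  - destruct (boettcher_root k z Hz) as [H1 H2].
    destruct (boettcher_root (S k) z Hz) as [H3 H4].
    assert (H := Croot_diff _ _ _ _ H4 H2). rewrite H1, H3 in H.
    replace (h K 0 z - h K 0 z)%C with (RtoC 0) in H by ring. rewrite Cmod_0 in H.
    specialize (IHk _ (fc_large z Hz)).
    assert (Ha := Cmod_h_ge K z HK). assert (Hc := Cmod_ge_0 c).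
    rewrite <- h_minus in H.
    assert (Hd := Cmod_h_ge K (psi (S (S k)) z - psi (S k) z) HK).
    assert (H0 := Cmod_ge_0 (psi (S (S k)) z - psi (S k) z)).
    rewrite <- tech_pow_Rmult. unfold r in *. nra.
Qed.

(** [is_boettcher] records only the convergence of the lifts; the conjugacy proved alongside is what
    lets [G0] of the coordinate extend along orbits. *)
Lemma boettcher_exists :
  exists phi : C -> C, is_boettcher K 0 c r phi /\
    forall z, r < Cmod z -> phi (fc K 0 c z) = fc K 0 0 (phi z).
Proof.
  set (phi := fun z => epsilon (inhabits (RtoC 0))
    (fun l => forall n, Cmod (psi n z - l) <= 4 * (1 / 2) ^ n)).
  assert (Hphi : forall z, r < Cmod z ->
            forall n, Cmod (psi n z - phi z) <= 4 * (1 / 2) ^ n).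
  { intros z Hz. unfold phi. apply epsilon_spec. apply geometric_limit_C.
    intros n. now apply boettcher_approx_step. }
  assert (Hu : forall eps, 0 < eps -> exists N : nat, forall n : nat, (N <= n)%nat ->
            forall z, r < Cmod z -> Cmod (psi n z - phi z) < eps).
  { intros eps He.
    destruct (pow_lt_1_zero (1 / 2)) with (y := eps / 4) as (N & HN);
      [rewrite Rabs_pos_eq; lra | lra |].
    exists N. intros n Hn z Hz. eapply Rle_lt_trans; [now apply Hphi|].
    specialize (HN n Hn). apply Rabs_def2 in HN. lra. }
  assert (Hlift : forall k z, r < Cmod z ->
            fc K 0 0 (psi (S k) z) = psi k (fc K 0 c z)).
  { intros k z Hz. unfold fc at 1. rewrite Cplus_0_r. now apply boettcher_root. }
  exists phi. split.
  - exists psi. split; [|exact Hu]. split; [exact fc_large|]. split; [reflexivity|].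
    intros k. split; [|split].
    + apply Hlift.
    + intros z Hz. now apply boettcher_approx_continuous.
    + intros P HP. apply locally_Cmod in HP. destruct HP as (e & He & HP).
      assert (Hc := Cmod_ge_0 c).
      exists (Rmax r ((1 + Cmod c) / e)). intros z Hz. apply HP.
      assert (Hz1 : r < Cmod z) by (eapply Rle_lt_trans; [apply Rmax_l | exact Hz]).
      assert (Hz2 : (1 + Cmod c) / e < Cmod z)
        by (eapply Rle_lt_trans; [apply Rmax_r | exact Hz]).
      replace (psi (S k) z - z - 0)%C with (psi (S k) z - z)%C by ring.
      apply Rmult_lt_compat_r with (r := e) in Hz2; [|exact He].
      unfold Rdiv in Hz2. rewrite Rmult_assoc, Rinv_l in Hz2 by lra.
      destruct (boettcher_approx_close (S k) z Hz1) as [H _].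
      unfold r in Hz1. apply Rmult_lt_reg_r with (Cmod z); lra.
  - intros z Hz.
    (* The relation [f_0 (psi (S k) z) = psi k (f_c z)] passes to the limit by continuity of [f_0]
       at [phi z] and convergence at [f_c z]. *)
    assert (E : Cmod (phi (fc K 0 c z) - fc K 0 0 (phi z)) = 0).
    { apply Rle_antisym; [|apply Cmod_ge_0]. apply le_epsilon. intros eps He.
      assert (He2 : 0 < eps / 2) by lra.
      destruct (proj1 (continuous_Cmod _ _) (continuous_fc K 0 (phi z)) _ He2)
        as (d & Hd & Hcont).
      destruct (Hu d Hd) as (N1 & HN1). destruct (Hu _ He2) as (N2 & HN2).
      set (n := (N1 + N2)%nat).
      specialize (HN1 (S n) ltac:(lia) z Hz).
      specialize (HN2 n ltac:(lia) _ (fc_large z Hz)).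
      specialize (Hcont _ HN1). rewrite Hlift in Hcont by exact Hz.
      rewrite Cmod_minus_sym in HN2.
      assert (H := Cmod_triangle_minus (phi (fc K 0 c z)) (psi n (fc K 0 c z))
                     (fc K 0 0 (phi z))). lra. }
    apply Cmod_eq_0 in E.
    replace (phi (fc K 0 c z))
      with ((phi (fc K 0 c z) - fc K 0 0 (phi z)) + fc K 0 0 (phi z))%C by ring.
    rewrite E. ring.
Qed.

(** The value [L n z] does not depend on [n] once the orbit is in the domain of [phi], since [G0]
    doubles under [f_0]. Any such time [N z] then defines the function at an escaping [z]. *)
Lemma green_exists : exists g, is_green K 0 c g.
Proof.
  destruct boettcher_exists as (phi & Hphi & Hconj).
  set (L := fun n z => G0 K 0 (phi (fiter K 0 c n z)) / 2 ^ n).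
  assert (HL : forall z n m, (n <= m)%nat -> r < Cmod (fiter K 0 c n z) ->
            r < Cmod (fiter K 0 c m z) /\ L m z = L n z).
  { intros z n m Hnm Hn. induction Hnm; [now split|].
    destruct IHHnm as [H1 H2]. split; [rewrite fiter_S; now apply fc_large|].
    rewrite <- H2. unfold L. rewrite fiter_S, Hconj, G0_fc by assumption.
    simpl. field. apply pow_nonzero. lra. }
  assert (HL' : forall z n m, r < Cmod (fiter K 0 c n z) ->
            r < Cmod (fiter K 0 c m z) -> L m z = L n z).
  { intros z n m Hn Hm. destruct (Nat.le_ge_cases n m).
    - now apply HL.
    - symmetry. now apply HL. }
  set (N := fun z => epsilon (inhabits 0%nat) (fun n => r < Cmod (fiter K 0 c n z))).
  assert (HN : forall z, escaping K 0 c z -> r < Cmod (fiter K 0 c (N z) z)).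
  { intros z Hz. unfold N.
    apply (epsilon_spec (inhabits 0%nat) (fun n => r < Cmod (fiter K 0 c n z))).
    destruct (escaping_reaches _ _ _ _ r Hz) as (n & Hn). exists n. now apply Hn. }
  exists (fun z => if excluded_middle_informative (escaping K 0 c z)
                   then L (N z) z else 0).
  split; [|split].
  - exists r, phi. split; [exact Hphi|]. intros z Hz.
    assert (He : escaping K 0 c z) by now apply escaping_large.
    destruct (excluded_middle_informative _) as [_|]; [|contradiction].
    rewrite (HL' z 0%nat (N z)); [|exact Hz|now apply HN].
    unfold L. simpl. field.
  - intros z Hz. assert (Hz' : escaping K 0 c (fc K 0 c z)) by now apply escaping_fc.
    destruct (excluded_middle_informative _) as [_|]; [|contradiction].
    destruct (excluded_middle_informative _) as [_|]; [|contradiction].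
    assert (H1 := HN _ Hz').
    assert (H2 : r < Cmod (fiter K 0 c (S (N (fc K 0 c z))) z)) by now rewrite <- fiter_fc.
    rewrite (HL' z _ _ H2 (HN z Hz)). unfold L. rewrite fiter_fc.
    simpl. field. apply pow_nonzero. lra.
  - intros z Hz. destruct (excluded_middle_informative _); [contradiction|reflexivity].
Qed.

End Boettcher.

(** * The positive real axis *)

Lemma fc_real (K c x : R) :
  fc K 0 (RtoC c) (RtoC x) = RtoC (K * x * (K * x) + c).
Proof. unfold fc. rewrite h_th0. apply Ceq; simpl; ring. Qed.

(** On the real axis multiplication by [K^2] conjugates [f_0] to squaring, so the estimate of
    [bounded0_small] becomes an equality. *)
Lemma Cmod_fiter0_real (K x : R) (n : nat) :
  K * K * Cmod (fiter K 0 0 n (RtoC x)) = (K * K * Rabs x) ^ (2 ^ n).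
Proof.
  assert (H : exists y, fiter K 0 0 n (RtoC x) = RtoC y /\
                        K * K * Rabs y = (K * K * Rabs x) ^ (2 ^ n)).
  { induction n.
    - exists x. split; [reflexivity|]. simpl. ring.
    - destruct IHn as (y & Hy & E). exists (K * y * (K * y) + 0). split.
      + rewrite fiter_S, Hy. apply fc_real.
      + rewrite Rplus_0_r. simpl (2 ^ S n)%nat. rewrite Nat.add_0_r, pow_add, <- E.
        rewrite !Rabs_mult.
        replace (Rabs K * Rabs y * (Rabs K * Rabs y))
          with (Rabs K * Rabs K * (Rabs y * Rabs y)) by ring.
        rewrite <- (Rabs_mult K K), (Rabs_pos_eq (K * K)) by nra. ring. }
  destruct H as (y & -> & E). now rewrite Cmod_R.
Qed.

Lemma escaping0_real (K x : R) :
  1 <= K -> 1 < K * K * x -> escaping K 0 0 (RtoC x).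
Proof.
  intros HK Hx. assert (Hx0 : 0 < x) by nra.
  (* Reaching [4 K^2] puts the iterate itself at modulus at least 4, beyond the escape radius 3. *)
  destruct (Pow_x_infinity (K * K * x)) with (b := 4 * (K * K)) as (n & Hn).
  { rewrite Rabs_pos_eq; lra. }
  apply (escaping_fiter K 0 (RtoC x) n). apply escaping_large; [exact HK|].
  rewrite Cmod_0. apply Rmult_lt_reg_l with (K * K); [nra|].
  rewrite Cmod_fiter0_real, (Rabs_pos_eq x) by lra.
  specialize (Hn (2 ^ n)%nat).
  assert (Hle : (2 ^ n >= n)%nat) by (apply Nat.lt_le_incl, Nat.pow_gt_lin_r; lia).
  specialize (Hn Hle). rewrite Rabs_pos_eq in Hn by (apply pow_le; lra). nra.
Qed.

Lemma ray_threshold_real (K x : R) :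
  1 <= K -> 0 < x -> ray_threshold K (RtoC x) (/ (K * K * x)).
Proof.
  intros HK Hx. assert (HKx : 0 < K * K * x) by (apply Rmult_lt_0_compat; nra).
  split; [now apply Rinv_0_lt_compat|]. split.
  - intros t Ht. rewrite <- RtoC_mult. apply escaping0_real; [exact HK|].
    apply Rmult_lt_compat_r with (r := K * K * x) in Ht; [|exact HKx].
    rewrite Rinv_l in Ht; lra.
  - intros t [Ht0 Ht]. apply bounded0_small; [exact HK|].
    rewrite Cmod_scal, Cmod_R, Rabs_pos_eq by lra.
    apply Rmult_lt_compat_r with (r := K * K * x) in Ht; [|exact HKx].
    rewrite Rinv_l in Ht; lra.
Qed.

Lemma G0_real (K x : R) :
  1 <= K -> 1 < K * K * x -> G0 K 0 (RtoC x) = ln (K * K * x).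
Proof.
  intros HK Hx. assert (Hx0 : 0 < x) by nra.
  rewrite (G0_threshold K _ (/ (K * K * x))).
  - rewrite ln_Rinv by lra. ring.
  - exact HK.
  - now apply ray_threshold_real.
  - now apply escaping0_real.
Qed.

(* The equation [f_0 (psi (S k) x) = psi k (f_c x) > 0] forces [psi (S k) x] to
   be real with absolute value at least [x]; being continuous and equivalent to
   [x] at infinity, it cannot change sign. *)
Lemma boettcher_seq_real (K c r : R) (psi : nat -> C -> C) :
  1 <= K -> 0 <= c -> is_boettcher_seq K 0 (RtoC c) r psi ->
  forall k x, 0 < x -> r < x -> exists p, psi k (RtoC x) = RtoC p /\ x <= p.
Proof.
  intros HK Hc (Hr & H0 & HS) k.
  assert (HC : forall x, 0 < x -> Cmod (RtoC x) = x).
  { intros x Hx. rewrite Cmod_R. apply Rabs_pos_eq. lra. }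
  induction k; intros x Hx Hrx.
  { exists x. rewrite H0 by now rewrite HC. split; [reflexivity|lra]. }
  destruct (HS k) as (Hlift & Hcont & Hlim).
  assert (Hroot : forall y, 0 < y -> r < y ->
    snd (psi (S k) (RtoC y)) = 0 /\ y <= Rabs (fst (psi (S k) (RtoC y)))).
  { intros y Hy Hry.
    assert (HKy : 0 < K * y) by nra.
    assert (Hf0 : 0 < K * y * (K * y) + c) by nra.
    assert (Hfr : r < K * y * (K * y) + c).
    { rewrite <- (HC _ Hf0), <- fc_real. apply Hr. now rewrite HC. }
    destruct (IHk _ Hf0 Hfr) as (p & Hp & Hpy).
    specialize (Hlift (RtoC y)). rewrite HC in Hlift by exact Hy.
    specialize (Hlift Hry). rewrite fc_real, Hp in Hlift.
    unfold fc in Hlift. rewrite Cplus_0_r, h_th0 in Hlift.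
    destruct (psi (S k) (RtoC y)) as [a b]. simpl.
    assert (E1 := f_equal fst Hlift). assert (E2 := f_equal snd Hlift).
    simpl in E1, E2.
    (* The imaginary part gives [a b = 0], and [a = 0] would make the positive number [p] equal to
       [- b^2]. *)
    assert (Hb : b = 0).
    { assert (Hab : a * b = 0) by nra. apply Rmult_integral in Hab.
      destruct Hab as [->|Hb]; [nra|exact Hb]. }
    split; [exact Hb|]. subst b. apply Rsqr_incr_0_var; [|apply Rabs_pos].
    rewrite <- Rsqr_abs. unfold Rsqr.
    assert (0 < K * K) by nra. nra. }
  destruct (Hroot x Hx Hrx) as [Hs Hf].
  exists (fst (psi (S k) (RtoC x))). split; [apply Ceq; simpl; trivial|].
  apply Rnot_lt_le. intros Hneg.
  assert (Hneg0 : fst (psi (S k) (RtoC x)) < 0).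
  { unfold Rabs in Hf. destruct (Rcase_abs _); lra. }
  destruct (Hlim (fun w => Cmod (w - 0) < 1)) as (R0 & HR0).
  { apply locally_Cmod. exists 1. split; [lra|trivial]. }
  set (y := Rmax (x + 1) (R0 + 1)).
  assert (Hy1 : x + 1 <= y) by apply Rmax_l.
  assert (Hy2 : R0 + 1 <= y) by apply Rmax_r.
  specialize (HR0 (RtoC y)). rewrite HC in HR0 by lra.
  specialize (HR0 ltac:(lra)).
  (* At [y] the real part is within 1 of [y > 1], so it is positive. *)
  assert (Hpos : 0 < fst (psi (S k) (RtoC y))).
  { destruct (Hroot y) as [_ Hy]; [lra | lra |].
    assert (E := Rabs_fst_le (psi (S k) (RtoC y) - RtoC y - 0)%C).
    simpl in E. unfold Rabs in Hy, E.
    destruct (Rcase_abs _) in Hy; destruct (Rcase_abs _) in E; simpl in *; lra. }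
  destruct (Ranalysis5.IVT_interv (fun t => fst (psi (S k) (RtoC t))) x y)
    as (z & Hz & Hz0); [|lra|exact Hneg0|exact Hpos|].
  - intros t Ht. apply continuity_pt_filterlim.
    apply (continuous_comp (fun t : R => RtoC t) (fun w => fst (psi (S k) w))).
    + apply continuous_pair; simpl; [apply continuous_id|apply continuous_const].
    + apply (continuous_comp (psi (S k)) (fun w : C => fst w)).
      * apply Hcont. rewrite HC; lra.
      * apply continuous_fst_C.
  (* A zero of the real part at [z] contradicts the lower bound [z > 0] on its absolute value. *)
  - destruct (Hroot z) as [_ Hzr]; [lra | lra |].
    rewrite Hz0, Rabs_R0 in Hzr. lra.
Qed.

Lemma boettcher_real (K c r : R) (psi : C -> C) (x : R) :
  1 <= K -> 0 <= c -> is_boettcher K 0 (RtoC c) r psi -> 0 < x -> r < x ->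
  exists p, psi (RtoC x) = RtoC p /\ x <= p.
Proof.
  intros HK Hc (psis & Hseq & Hu) Hx Hrx.
  assert (HC : r < Cmod (RtoC x)) by (rewrite Cmod_R, Rabs_pos_eq; lra).
  assert (H : forall eps, 0 < eps -> Rabs (snd (psi (RtoC x))) <= eps /\
                                     x - eps <= fst (psi (RtoC x))).
  { intros eps He. destruct (Hu eps He) as (N & HN).
    specialize (HN N (le_n N) _ HC).
    destruct (boettcher_seq_real K c r psis HK Hc Hseq N x Hx Hrx) as (p & Hp & Hxp).
    rewrite Hp in HN. rewrite Cmod_minus_sym in HN.
    assert (E1 := Rabs_fst_le (psi (RtoC x) - RtoC p)).
    assert (E2 := Rabs_snd_le (psi (RtoC x) - RtoC p)).
    simpl in E1, E2. rewrite Ropp_0, Rplus_0_r in E2. split; [lra|].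
    assert (E3 := Rle_abs (- (fst (psi (RtoC x)) + - p))).
    rewrite Rabs_Ropp in E3. lra. }
  exists (fst (psi (RtoC x))). split.
  - apply Ceq; [reflexivity|]. simpl.
    destruct (Req_dec (snd (psi (RtoC x))) 0) as [E|E]; [exact E|].
    apply Rabs_pos_lt in E.
    destruct (H (Rabs (snd (psi (RtoC x))) / 2)); lra.
  - apply Rnot_lt_le. intros Hlt.
    destruct (H ((x - fst (psi (RtoC x))) / 2)); lra.
Qed.

(** The radius and the coordinate are those witnessing [is_green] for [g], so the bound applies to
    the function that [epsilon] selects in [G]. *)
Lemma green_real_large (K c : R) (g : C -> R) :
  1 <= K -> 0 <= c -> is_green K 0 (RtoC c) g ->
  exists R0, forall x, R0 < x -> ln (K * K * x) <= g (RtoC x).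
Proof.
  intros HK Hc ((r & psi & Hpsi & Hg) & _).
  exists (Rmax r 1). intros x Hx.
  assert (Hx1 := Rmax_l r 1). assert (Hx2 := Rmax_r r 1).
  destruct (boettcher_real K c r psi x HK Hc Hpsi) as (p & Hp & Hxp); [lra|lra|].
  rewrite Hg by (rewrite Cmod_R, Rabs_pos_eq; lra).
  assert (1 <= K * K) by nra.
  rewrite Hp, G0_real; [|exact HK|nra].
  apply ln_le; nra.
Qed.

Lemma green_fiter (K th : R) (c z : C) (g : C -> R) (n : nat) :
  is_green K th c g -> escaping K th c z -> g (fiter K th c n z) = 2 ^ n * g z.
Proof.
  intros (_ & Hg & _) Hz. induction n; [simpl; ring|].
  rewrite fiter_S, Hg, IHn; [simpl; ring|].
  unfold escaping in *. apply (is_lim_seq_incr_n _ n) in Hz. revert Hz.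
  apply is_lim_seq_ext. intros k. now rewrite fiter_add.
Qed.

Fixpoint real_orbit (K c x : R) (n : nat) : R :=
  match n with
  | O => x
  | S n => K * real_orbit K c x n * (K * real_orbit K c x n) + c
  end.

Lemma fiter_real (K c x : R) (n : nat) :
  fiter K 0 (RtoC c) n (RtoC x) = RtoC (real_orbit K c x n).
Proof. induction n; [reflexivity|]. rewrite fiter_S, IHn. apply fc_real. Qed.

(** As [c >= 0], each step at least doubles [ln (K^2 x_n)], while [g] doubles exactly. The
    inequality is therefore pulled back from a late iterate, where [green_real_large] holds. *)
Lemma green_real_ge (K c x : R) (g : C -> R) (n : nat) :
  1 <= K -> 0 <= c -> 0 < x -> is_green K 0 (RtoC c) g ->
  escaping K 0 (RtoC c) (RtoC x) ->
  ln (K * K * real_orbit K c x n) <= 2 ^ n * g (RtoC x).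
Proof.
  intros HK Hc Hx Hg He.
  destruct (green_real_large K c g HK Hc Hg) as (R0 & HR0).
  destruct (escaping_reaches _ _ _ _ (Rmax R0 0) He) as (N & HN).
  assert (Hpos : forall m, 0 < real_orbit K c x m).
  { induction m; simpl; [exact Hx|].
    assert (0 < K * real_orbit K c x m) by nra. nra. }
  assert (HKK : 1 <= K * K) by nra.
  assert (Hmono : forall m, ln (K * K * real_orbit K c x n) * 2 ^ m <=
                            ln (K * K * real_orbit K c x (m + n))).
  { induction m; [simpl; lra|]. simpl (2 ^ S m).
    set (u := real_orbit K c x (m + n)) in *.
    assert (Hu : 0 < u) by apply Hpos.
    apply Rle_trans with (2 * ln (K * K * u)); [lra|].
    replace (2 * ln (K * K * u)) with (ln (K * K * u) + ln (K * K * u)) by ring.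
    assert (0 < K * K * u) by nra.
    rewrite <- ln_mult by assumption. apply ln_le; [nra|].
    simpl. fold u. nra. }
  specialize (HN (N + n)%nat ltac:(lia)).
  rewrite fiter_real, Cmod_R, (Rabs_pos_eq _ (Rlt_le _ _ (Hpos _))) in HN.
  specialize (HR0 (real_orbit K c x (N + n))).
  assert (HM := Rmax_l R0 0). specialize (HR0 ltac:(lra)).
  rewrite <- fiter_real, (green_fiter _ _ _ _ _ _ Hg He) in HR0.
  specialize (Hmono N). rewrite pow_add in HR0.
  assert (0 < 2 ^ N) by (apply pow_lt; lra).
  apply Rmult_le_reg_l with (2 ^ N); [assumption|]. lra.
Qed.

(** * The parameter [1 / (2 K)] *)

Lemma escaping_cK (K : R) :
  1 <= K -> escaping K 0 (RtoC (1 / (2 * K))) (RtoC (1 / (2 * K))).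
Proof.
  intros HK. set (c := 1 / (2 * K)).
  assert (Hc : 0 < c) by (apply Rdiv_lt_0_compat; lra).
  assert (HKc : K * c = 1 / 2) by (unfold c; field; lra).
  (* [(K x - c)^2 >= 0] reads [K^2 x^2 - x + c^2 >= 0], and [c^2 <= c / 2]. *)
  assert (Hinc : forall n, INR n * (c / 2) <= real_orbit K c c n).
  { induction n; [simpl; lra|]. rewrite S_INR. simpl.
    set (x := real_orbit K c c n) in *.
    assert (E : K * x * (K * x) - x + c * c = (K * x - c) * (K * x - c)).
    { replace ((K * x - c) * (K * x - c))
        with (K * x * (K * x) - 2 * (K * c) * x + c * c) by ring.
      rewrite HKc. field. }
    assert (0 <= (K * x - c) * (K * x - c)) by apply Rle_0_sqr.
    assert (c * c <= c / 2) by nra. lra. }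
  (* Linear growth by [c / 2] per step passes [c + 4], beyond the escape radius [c + 3]. *)
  destruct (INR_unbounded ((c + 4) / (c / 2))) as (n & Hn).
  apply (escaping_fiter K _ _ n). apply escaping_large; [exact HK|].
  rewrite fiter_real, !Cmod_R. rewrite (Rabs_pos_eq c) by lra.
  eapply Rlt_le_trans; [|apply Rle_abs]. eapply Rlt_le_trans; [|apply Hinc].
  apply Rmult_gt_compat_r with (r := c / 2) in Hn; [|lra].
  unfold Rdiv at 2 in Hn. rewrite Rmult_assoc, Rinv_l in Hn; lra.
Qed.

Lemma not_Mandel_cK (K : R) : 1 <= K -> ~ Mandel K 0 (RtoC (1 / (2 * K))).
Proof.
  (* [Mandel] follows the orbit of 0, whose first iterate is the parameter. *)
  intros HK H. apply H. apply escaping_fc. rewrite fc_real.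
  replace (K * 0 * (K * 0) + 1 / (2 * K)) with (1 / (2 * K)) by (field; lra).
  now apply escaping_cK.
Qed.

(** * The series [sigma] and the threshold [t0] *)

Lemma sigma_partial_ge (K th : R) (c : C) (n : nat) :
  (forall i, Pn K th i c <> 0%C) -> (1 <= n)%nat ->
  1 / (2 * Cmod (h K th c)) <= real (sigma_partial K th n c).
Proof.
  intros Hc Hn. unfold sigma_partial.
  destruct (excluded_middle_informative _) as [(i & _ & Hi)|_].
  { now elim (Hc i). }
  simpl. set (f := fun i => 1 / (2 * Cmod (h K th (Pn K th i c)))).
  assert (Hf : forall i, 0 <= f i).
  { intros i. unfold f, Rdiv. rewrite Rmult_1_l.
    assert (E := Cmod_ge_0 (h K th (Pn K th i c))).
    destruct (Req_dec (Cmod (h K th (Pn K th i c))) 0) as [->|Hne].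
    - rewrite Rmult_0_r, Rinv_0. lra.
    - left. apply Rinv_0_lt_compat. lra. }
  assert (Hp : forall m, 0 <= prod_f_R0 f m).
  { induction m; simpl; [apply Hf|]. now apply Rmult_le_pos. }
  induction Hn.
  - rewrite sum_n_n. simpl. apply Rle_refl.
  - rewrite sum_n_Sm by lia. eapply Rle_trans; [exact IHHn|].
    (* The new term has product index [S m - 1], which reduces to [m - 0]. *)
    unfold plus; simpl. specialize (Hp (m - 0)%nat).
    match goal with |- ?a <= _ + ?b => assert (0 <= b) by exact Hp; lra end.
Qed.

Lemma sigma_cK (K : R) :
  1 <= K -> Rbar_le (Finite 1) (sigma_series K 0 (RtoC (1 / (2 * K)))).
Proof.
  intros HK. unfold sigma_series.
  destruct (excluded_middle_informative _) as [_|Hex]; [exact I|].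
  rewrite <- (Lim_seq_const 1). apply Lim_seq_le_loc. exists 1%nat. intros n Hn.
  eapply Rle_trans; [|apply sigma_partial_ge; [|exact Hn]].
  - rewrite h_th0. simpl. unfold Cmod. simpl.
    (* [K c_K = 1/2], so [|h c_K| = 1/2] and the first term is exactly 1. *)
    replace (_ + _) with ((1 / 2) * (1 / 2)) by (field; lra).
    rewrite sqrt_square; lra.
  - intros i Hi. apply Hex. now exists i.
Qed.

(** An admissible [t] below [GM c], used with [s = t], would put [c] in [Omega_star] and force
    [sigma c < 1]. *)
Lemma t0_ge_GM (K th : R) (c : C) :
  Rbar_le (Finite 1) (sigma_series K th c) -> Rbar_le (Finite (GM K th c)) (t0 K th).
Proof.
  intros Hs. unfold t0. destruct (Glb_Rbar_correct (fun t => 0 < t /\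
    forall s, t <= s -> forall c, s < GM K th c -> Omega_star K th c)) as [_ Hglb].
  apply Hglb. intros t [_ Ht]. simpl. apply Rnot_lt_le. intros Hlt.
  destruct (Ht t (Rle_refl t) c Hlt) as [_ H].
  now apply (Rbar_le_not_lt _ _ Hs).
Qed.

(** Cubing suffices: [(8/5)^3 = 4.096 > 3 >= e >= exp (12/13)]. *)
Lemma exp_4_13 : exp (4 / 13) <= 8 / 5.
Proof.
  apply Rnot_lt_le. intros H.
  assert (H3 := exp_le_3).
  assert (E : exp 1 >= exp (4 / 13) * (exp (4 / 13) * exp (4 / 13))).
  { rewrite <- !exp_plus. apply Rle_ge.
    destruct (Req_dec (4 / 13 + (4 / 13 + 4 / 13)) 1) as [->|Hne]; [lra|].
    left. apply exp_increasing. lra. }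
  nra.
Qed.

Theorem lemma7p1 (K : R) (hK : 1 <= K) :
  let cK : C := RtoC (1 / (2 * K)) in
  ~ Mandel K 0 cK /\
  Rbar_le (Finite 1) (sigma_series K 0 cK) /\
  Rbar_le (Finite (GM K 0 cK)) (t0 K 0) /\
  0 < GM K 0 cK /\
  (K <= 2 -> 1 / 26 <= GM K 0 cK).
Proof.
  intros cK.
  assert (Hc : 0 < 1 / (2 * K)) by (apply Rdiv_lt_0_compat; lra).
  assert (Hg : is_green K 0 cK (G K 0 cK)).
  { unfold G. apply epsilon_spec. now apply green_exists. }
  assert (He := escaping_cK K hK).
  assert (Hge : forall n,
    ln (K * K * real_orbit K (1 / (2 * K)) (1 / (2 * K)) n) <= 2 ^ n * GM K 0 cK).
  { intros n. apply (green_real_ge K _ _ (G K 0 cK)); trivial. lra. }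
  assert (Hs := sigma_cK K hK).
  split; [now apply not_Mandel_cK|]. split; [exact Hs|].
  split; [now apply t0_ge_GM|].
  (* The third iterate already gives [K^2 P_3 >= 1.62 > exp (8 / 26)]. *)
  assert (H3 : 4 / 13 <= 2 ^ 3 * GM K 0 cK).
  { eapply Rle_trans; [|apply (Hge 3%nat)].
    rewrite <- (ln_exp (4 / 13)). apply ln_le; [apply exp_pos|].
    eapply Rle_trans; [apply exp_4_13|].
    assert (Hstep : forall n,
      K * K * real_orbit K (1 / (2 * K)) (1 / (2 * K)) (S n) =
      (K * K * real_orbit K (1 / (2 * K)) (1 / (2 * K)) n) ^ 2 + K / 2).
    { intros n. simpl. field. lra. }
    assert (E0 : K * K * real_orbit K (1 / (2 * K)) (1 / (2 * K)) 0 = K / 2).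
    { simpl. field. lra. }
    rewrite !Hstep, E0.
    (* The bounds are the values at [K = 1], where [u = 1/2] goes to [3/4], [17/16], then
       [417/256 > 8/5]; the iterates increase with [K]. *)
    assert (H1 : 3 / 4 <= (K / 2) ^ 2 + K / 2) by nra.
    assert (H2 : 17 / 16 <= ((K / 2) ^ 2 + K / 2) ^ 2 + K / 2) by nra.
    nra. }
  simpl (2 ^ 3) in H3. split; [lra|]. intros _. lra.
Qed.
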